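(* Let $d,k\ge 1$ be integers, $n=dk$, and let $M_0,M_1,\dots,M_{d-1}\in\mathbb{C}^{k\times k}$ with $M_0$ lower triangular. Let $S\in\mathbb{C}^{n\times n}$ be the block companion matrix $$S=\begin{bmatrix} & & & & -M_0\\ I_k & & & & -M_1\\ & I_k & & & \\ & & \ddots & & \vdots\\ & & & I_k & -M_{d-1}\end{bmatrix}.$$ Then $S$ can be factored as $S=S_1S_2\cdots S_k$, where each $S_i\in\mathbb{C}^{n\times n}$ is the Frobenius companion matrix linked to a scalar monic polynomial of degree $n$.
   Context: $I_k$ is the $k\times k$ identity matrix; blank entries are zero. The matrix $S$ has $k\times k$ blocks: identity blocks on the block subdiagonal, the blocks $-M_0,\dots,-M_{d-1}$ (from top to bottom) in the last block column, and zeros elsewhere. The Frobenius companion matrix linked to the scalar monic polynomial $\lambda^n+a_{n-1}\lambda^{n-1}+\dots+a_1\lambda+a_0$, with $a_i\in\mathbb{C}$, is the $n\times n$ matrix with ones on the subdiagonal, last column $[-a_0,-a_1,\dots,-a_{n-1}]^T$, and zeros elsewhere; equivalently it is $J-ae_n^T$ with $J$ the nilpotent downshift matrix (ones on the subdiagonal, zeros elsewhere) and $a=[a_0,\dots,a_{n-1}]^T\in\mathbb{C}^n$. *)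

(* Defs.v *)
From HB Require Import structures.
From mathcomp Require Import all_boot all_order all_algebra.

Set Implicit Arguments.
Unset Strict Implicit.
Unset Printing Implicit Defensive.

Import GRing.Theory.
Local Open Scope ring_scope.

(* Only meaningful for p monic of size n.+1.  In that case it is, up to a cast
   of the dimension (size p).-1 = n, the transpose of mxpoly's companionmx,
   which has the coefficients in the last row instead of the last column.     *)
Definition frobenius_companion (F : nzRingType) (n : nat) (p : {poly F}) :
    'M[F]_n :=
  \matrix_(i, j) if j.+1 == n then - p`_i else (i == j.+1 :> nat)%:R.

Fact block_dim (d k : nat) : (\sum_(i < d) k = d * k)%N.
Proof. by rewrite sum_nat_const card_ord. Qed.

(* The cast is only needed because \mxblock produces a matrix of dimension
   \sum_(i < d) k, which is not convertible to d * k.                         *)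
Definition block_companion (F : nzRingType) (d k : nat)
    (M : 'I_d -> 'M[F]_k) : 'M[F]_(d * k) :=
  castmx (block_dim d k, block_dim d k)
    (\mxblock_(i < d, j < d)
       (if j.+1 == d then - M i
        else if i == j.+1 :> nat then 1%:M else 0 : 'M[F]_k)).

(* Main.v *)
(* Write C_a for the Frobenius companion matrix with last column -a, and J for
   the downshift matrix.  A product C_(a_0) ... C_(a_(k-1)) sends e_c to e_(c+k) as long
   as c + k < n, and sends e_(n-k+j) to -C_(a_0) ... C_(a_(j-1)) a_j for j < k.  So
   the task is to solve C_(a_0) ... C_(a_(j-1)) a_j = m_j, where m_j is the
   j-th column of the stacked matrix [M_0; ...; M_(d-1)].  Since M_0 is lower
   triangular, the first j entries of m_j vanish, and a_j can be taken to be
   m_j shifted up by j places: its last j entries vanish, so each of the j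
   factors acts on it as J. *)
Require Import Defs.
From mathcomp Require Import all_boot all_order all_algebra.
From mathcomp Require Import reals complex.
From mathcomp Require Import zify.

Import GRing.Theory.

Local Open Scope ring_scope.
Local Open Scope complex_scope.

Definition shifted_poly {F : nzRingType} (n j : nat) (v : nat -> F) : {poly F} :=
  'X^n + \poly_(r < n - j) v (r + j)%N.

Lemma size_shifted_poly_tail (F : nzRingType) (n j : nat) (v : nat -> F) :
  (size (\poly_(r < n - j) v (r + j)%N) < size ('X^n : {poly F}))%N.
Proof. by rewrite size_polyXn ltnS (leq_trans (size_poly _ _)) ?leq_subr. Qed.

Lemma size_shifted_poly (F : nzRingType) (n j : nat) (v : nat -> F) :
  size (shifted_poly n j v) = n.+1.
Proof. by rewrite size_polyDl ?size_shifted_poly_tail ?size_polyXn. Qed.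

Lemma monic_shifted_poly (F : nzRingType) (n j : nat) (v : nat -> F) :
  shifted_poly n j v \is monic.
Proof.
by rewrite monicE lead_coefDl ?size_shifted_poly_tail ?lead_coefXn.
Qed.

Lemma coef_shifted_poly (F : nzRingType) (n j : nat) (v : nat -> F) (r : nat) :
  (r < n)%N ->
  (shifted_poly n j v)`_r = if (r + j < n)%N then v (r + j)%N else 0.
Proof.
by move=> rn; rewrite coefD coefXn coef_poly ltn_eqF // add0r ltn_subRL addnC.
Qed.

(** Induction on [t], splitting off the rightmost factor: its columns before the last only shift the
    columns of the partial product, and its last one yields the new column [- m r t]. *)
Lemma prod_frobenius_companion (F : nzRingType) (n t : nat)
    (m : nat -> nat -> F) :
  (forall j r, (j < t)%N -> (r < j)%N -> m r j = 0) ->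
  \prod_(j < t) frobenius_companion n (shifted_poly n j (m^~ j)) =
  \matrix_(r < n, c < n) if (c + t < n)%N then (r == (c + t)%N :> nat)%:R
                         else - m r (c + t - n)%N.
Proof.
elim: t => [|t IHt] m0.
  by rewrite big_ord0; apply/matrixP => r c; rewrite !mxE addn0 ltn_ord.
rewrite big_ord_recr /= IHt; last by move=> j r jt; apply/m0/ltnW.
apply/matrixP => r c; rewrite !mxE.
case: (ltnP c.+1 n) => [cn|nc].
  rewrite (bigD1 (Ordinal cn)) //= big1 => [|l /eqP lc]; rewrite !mxE (ltn_eqF cn).
    by rewrite /= eqxx mulr1 addr0 addSnnS.
  rewrite (_ : (l == c.+1 :> nat) = false) ?mulr0 //.
  by apply/eqP => e; apply/lc/val_inj.
have cE : c.+1 = n by apply/eqP; rewrite eqn_leq ltn_ord.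
have -> : (c + t.+1 < n)%N = false by lia.
have -> : (c + t.+1 - n)%N = t by lia.
under eq_bigr => l _ do rewrite !mxE cE eqxx coef_shifted_poly ?ltn_ord //.
(* The coefficient at [l] is zero once [l + t >= n], so only columns of the partial product equal to
   e_(l + t) contribute; row [r] meets just [l = r - t], if [t <= r]. *)
case: (leqP t r) => [tr|rt].
  have ln : (r - t < n)%N by have := ltn_ord r; lia.
  rewrite (bigD1 (Ordinal ln)) //= big1 => [|l /eqP lr]; last first.
    case: ifP => _; last by rewrite oppr0 mulr0.
    rewrite (_ : (r == (l + t)%N :> nat) = false) ?mul0r //.
    by apply/eqP => e; apply/lr/val_inj; rewrite /= e addnK.
  by rewrite subnK // ltn_ord eqxx mul1r addr0.
rewrite m0 // oppr0 big1 // => l _.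
case: ifP => _; last by rewrite oppr0 mulr0.
by rewrite (_ : (r == (l + t)%N :> nat) = false) ?mul0r //; lia.
Qed.

(** All blocks preceding that of [s] have size [k], so block coordinates are quotient and remainder
    by [k]. *)
Lemma tagnat_const (d k : nat) (s : 'I_(\sum_(i < d) k)) :
  s = (tagnat.sig1 s * k + tagnat.sig2 s)%N :> nat.
Proof.
rewrite [LHS]tagnat.rect -(big_ord_widen _ (fun=> k)) ?sum_nat_const ?card_ord //.
exact: ltnW.
Qed.

(** Brings the block matrix to the entrywise form of [prod_frobenius_companion] with [k.+1]
    factors. *)
Lemma block_companionE (F : nzRingType) (d k : nat)
    (M : 'I_d.+1 -> 'M[F]_k.+1) (r c : 'I_(d.+1 * k.+1)) :
  block_companion M r c =
  if (c + k.+1 < d.+1 * k.+1)%N then (r == (c + k.+1)%N :> nat)%:R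
  else - M (inord (r %/ k.+1)) (inord (r %% k.+1))
           (inord (c + k.+1 - d.+1 * k.+1)).
Proof.
rewrite castmxE mxE.
set r' := cast_ord _ r; set c' := cast_ord _ c.
have := tagnat_const _ _ r'; have := tagnat_const _ _ c'.
move: (tagnat.sig1 r') (tagnat.sig2 r') (tagnat.sig1 c') (tagnat.sig2 c').
move=> i a j b /= -> ->.
rewrite divnMDl // modnMDl (divn_small (ltn_ord a)) (modn_small (ltn_ord a)).
rewrite addn0 !inord_val eqSS.
case: eqP => [->|jd].
  rewrite ltnNge mulSn addnAC [(d * _ + _)%N]addnC leq_addr /=.
  by rewrite addKn inord_val mxE.
have jd1 : (j < d)%N by have := ltn_ord j; lia.
have := ltn_ord a; have := ltn_ord b; move=> bk ak.
rewrite (_ : (_ < _)%N); last by nia.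
rewrite addnAC -mulSnr.
case: (eqVneq (i : nat) j.+1) => [->|ij].
  by rewrite mxE eqn_add2l.
rewrite mxE (_ : (_ == _ :> nat) = false) //; apply/eqP => e.
(* Equal flat indices would have equal block indices. *)
case/eqP: ij; have /(congr1 (divn^~ k.+1)) := e.
by rewrite !divnMDl // !divn_small // !addn0.
Qed.

Theorem theorem1 (R : realType) (d k : nat) (hd : (0 < d)%N) (hk : (0 < k)%N)
    (M : 'I_d -> 'M[R[i]]_k)
    (hM0 : is_trig_mx (M (Ordinal hd))) :
  exists S : 'I_k -> 'M[R[i]]_(d * k),
    (forall i : 'I_k, exists p : {poly R[i]},
       [/\ p \is monic, size p = (d * k).+1
         & S i = frobenius_companion (d * k) p]) /\
    block_companion M = \prod_(i < k) S i.
Proof.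
case: d k hd hk M hM0 => [|d] [|k] // hd _ M hM0.
pose m r j := M (inord (r %/ k.+1)) (inord (r %% k.+1)) (inord j).
pose p j := shifted_poly (d.+1 * k.+1) j (m^~ j).
exists (fun j => frobenius_companion _ (p j)); split.
  by move=> j; exists (p j); rewrite monic_shifted_poly size_shifted_poly.
rewrite prod_frobenius_companion => [|j r jk rj].
  by apply/matrixP => r c; rewrite block_companionE mxE.
(* Rows [r < j < k.+1] lie in the top block, so triangularity of M_0 applies. *)
have rk := ltn_trans rj jk.
rewrite /m divn_small // modn_small // (_ : inord 0 = Ordinal hd).
  by apply: (is_trig_mxP hM0); rewrite !inordK.
by apply/val_inj; rewrite /= inordK.
Qed.
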